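(* Let $A$ and $B$ be two unbounded symmetric operators on a Hilbert space $H$. Let $D$ be a dense linear manifold contained in the domain $D[(A+B)^2]$. If $D$ is a core for $(A+B)^*(\overline{A+B})$, then $A+B$ is essentially self-adjoint on $D$.
   Context: Operators are linear and not necessarily bounded (''unbounded'' means not necessarily bounded); symmetric operators are densely defined. Sums and products carry their natural domains: $D(A+B)=D(A)\cap D(B)$ and $D(AB)=\{x\in D(B): Bx\in D(A)\}$; in particular $(A+B)^2=(A+B)(A+B)$. $\overline{A+B}$ denotes the closure of $A+B$. A linear subspace $D\subset D(T)$ is a core for a closed operator $T$ if the closure of the restriction $T|_D$ equals $T$. An operator $T$ is essentially self-adjoint on $D\subset D(T)$ if the restriction $T|_D$ is essentially self-adjoint, i.e. its closure is self-adjoint. *)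

(* Defs.v *)
From mathcomp Require Export all_boot all_order all_algebra.
From mathcomp Require Export all_classical all_reals all_analysis.
From mathcomp Require Export sesquilinear complex.
Export numFieldNormedType.Exports.

Set Implicit Arguments.
Unset Strict Implicit.
Unset Printing Implicit Defensive.

Import Order.TTheory GRing.Theory Num.Theory.
Local Open Scope classical_set_scope.
Local Open Scope ring_scope.

(* A complex Hilbert space is a complete normed space H over R[i] together with
   an inner product [dot], linear in its first argument and conjugate-linear
   in its second one, that induces the norm. *)
Definition induces_norm (R : realType) (H : completeNormedModType R[i])
  (dot : {dot H for Num.conj}) : Prop :=
  forall x : H, dot x x = `|x| ^+ 2.

(* A linear operator T with domain D(T) in H is identified with its graph,
   a set of pairs: [T (x, y)] reads "x \in D(T) and T x = y". Equality of
   operators is thus equality of the domains and of the values. *)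
Section Operators.
Context {R : realType} {H : completeNormedModType R[i]}.
Implicit Types (S T : set (H * H)) (D : set H).

Definition linear_manifold {V : lmodType R[i]} (D : set V) : Prop :=
  GRing.submod_closed (mem D).

Definition is_operator T : Prop :=
  linear_manifold T /\ forall x y z, T (x, y) -> T (x, z) -> y = z.

Definition op_dom T : set H := [set x | exists y, T (x, y)].

Definition op_add S T : set (H * H) :=
  [set p | exists y z, [/\ S (p.1, y), T (p.1, z) & p.2 = y + z]].

(* D(ST) = {x \in D(T) : T x \in D(S)} *)
Definition op_mul S T : set (H * H) :=
  [set p | exists2 y, T (p.1, y) & S (y, p.2)].

Definition op_restrict T D : set (H * H) := [set p | T p /\ D p.1].

(* The closure in the product topology of H * H; it is the graph of an operator
   exactly when T is closable. *)
Definition op_closure T : set (H * H) := closure T.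

Definition is_core D T : Prop :=
  [/\ linear_manifold D, D `<=` op_dom T &
      (* this makes T closed *)
      op_closure (op_restrict T D) = T].

Variable dot : {dot H for Num.conj}.

(* x \in D(T^* ) and T^* x = y if and only if <T u, x> = <u, y> for all u in
   D(T); when D(T) is dense, y is determined by x. *)
Definition adjoint T : set (H * H) :=
  [set p | forall u v, T (u, v) -> dot v p.1 = dot u p.2].

Definition symmetric_op T : Prop :=
  [/\ is_operator T, dense (op_dom T) &
      forall x y u v, T (x, y) -> T (u, v) -> dot y u = dot x v].

Definition self_adjoint T : Prop :=
  [/\ is_operator T, dense (op_dom T) & adjoint T = T].

Definition essentially_self_adjoint T : Prop := self_adjoint (op_closure T).

Definition essentially_self_adjoint_on T D : Prop :=
  [/\ linear_manifold D, D `<=` op_dom T &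
      essentially_self_adjoint (op_restrict T D)].

End Operators.

(* Main.v *)
From HB Require Import structures.
Require Import Defs.
From mathcomp Require Import ring.

(** Write T = A + B and let D be as in the theorem. Everything takes place in
    the Hilbert space H * H, with the sum of the inner products, where
    orthogonal projection onto closed subspaces is available.

    The graph of the adjoint T* is, up to a rotation, the orthogonal complement
    of the graph of T; hence T* is closed and does not change when T is
    replaced by its closure T'. Projecting (h, 0) onto the graph of T' gives
    von Neumann's observation that 1 + T* T' is onto
    ([range_one_plus_adjoint_mul]). If D is a core for T* T', the vectors
    u + T* T' u with u in D are therefore dense: only 0 is orthogonal to all of
    them ([core_range_dense]).

    Let now C be the closure of the restriction of T to D; since T is
    symmetric, C is contained in T' and T' in T*. Conversely, T* is contained
    in C. Indeed, subtract from an element of T* its projection onto C; what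
    remains is some (a, b) in T* orthogonal to C. For u in D, the vector T u is
    again in the domain of T and T T u = T* T' u, so
      <a, u> = - <b, T u> = - <a, T T u>,
    the second equality being b = T* a tested on T u. Hence a is orthogonal to
    all the u + T* T' u, so a = 0, and b = T* 0 = 0. Thus C = T' = T*, and the
    adjoint of C is T* = C: the restriction of T to D is essentially
    self-adjoint. *)

Set Implicit Arguments.
Unset Strict Implicit.
Unset Printing Implicit Defensive.

Import Order.TTheory GRing.Theory Num.Theory.
Local Open Scope classical_set_scope.
Local Open Scope ring_scope.

(** * Subspaces, completeness and infima *)

Lemma linear_manifoldP (R : realType) (V : lmodType R[i]) (D : set V) :
  linear_manifold D <->
  D 0 /\ forall a u v, D u -> D v -> D (a *: u + v).
Proof.
split=> [[/set_mem D0 Dlin]|[D0 Dlin]].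
  by split=> // a u v /mem_set Du /mem_set Dv; exact/set_mem/Dlin.
by split=> [|a u v /set_mem Du /set_mem Dv]; apply/mem_set => //; exact: Dlin.
Qed.

Lemma linear_closure (R : realType) (V : normedModType R[i]) (D : set V) :
  linear_manifold D -> linear_manifold (closure D).
Proof.
move=> /linear_manifoldP[D0 Dlin]; apply/linear_manifoldP.
split=> [|a u v]; first exact: subset_closure.
have step (f : V -> V) : continuous f ->
    (forall w, D w -> closure D (f w)) ->
    forall w, closure D w -> closure D (f w).
  move=> /continuous_closedP fcont AD w; rewrite {1}closureE.
  apply: (smallest_sub (X := f @^-1` closure D)) => //.
  by apply: fcont; exact: closed_closure.
move=> Du Dv; apply: (step (fun w => a *: w + v)) Du => [w|w Dw].
  by apply: cvgD; [apply: cvgZ; [exact: cvg_cst|exact: cvg_id]|exact: cvg_cst].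
apply: (step (fun z => a *: w + z)) Dv => [z|z Dz].
  by apply: cvgD; [exact: cvg_cst|exact: cvg_id].
by apply: subset_closure; exact: Dlin.
Qed.

Lemma prod_complete (K : numFieldType) (U V : completeNormedModType K)
    (F : set_system (U * V)) :
  ProperFilter F -> cauchy F -> exists l : U * V, F --> l.
Proof.
move=> FF /cauchyP F_cauchy.
have F1 : cvg (fst @ F).
  apply: cauchy_cvg; apply/cauchyP => e e0; have [p Fp] := F_cauchy e e0.
  exists p.1; rewrite nbhs_filterE.
  by apply: (@filterS _ F _ (ball p e)) => // q [].
have F2 : cvg (snd @ F).
  apply: cauchy_cvg; apply/cauchyP => e e0; have [p Fp] := F_cauchy e e0.
  exists p.2; rewrite nbhs_filterE.
  by apply: (@filterS _ F _ (ball p e)) => // q [].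
have [l1 h1] : exists l : U, fst @ F --> l by exists (lim (fst @ F)).
have [l2 h2] : exists l : V, snd @ F --> l by exists (lim (snd @ F)).
exists (l1, l2).
have h : (fun p : U * V => (p.1, p.2)) @ F --> (l1, l2).
  by apply: cvg_pair; [exact: h1|exact: h2].
apply: cvg_trans h => P; rewrite !nbhs_filterE => FP.
by apply: (@filterS _ F _ _ _ _ FP) => -[].
Qed.

(** The order of R[i] is partial, but it is that of R on nonnegative
    elements. *)
Lemma nneg_complex_inf (R : realType) (A : set R[i]) :
  A !=set0 -> (forall a, A a -> 0 <= a) ->
  exists2 d, (forall a, A a -> d <= a) &
             forall e, 0 < e -> exists2 a, A a & a < d + e.
Proof.
move=> [a0 Aa0] A0; pose B := (@complex.Re R) @` A.
have ReA a : A a -> a = (complex.Re a)%:C%C.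
  by move=> /A0/ger0_real/RRe_real.
have lbB : has_lbound B.
  exists 0 => _ [a Aa <-]; rewrite -lecR -ReA//; exact: A0.
have infB : has_inf B by split=> //; exists (complex.Re a0), a0.
exists (inf B)%:C%C => [a Aa|e e0].
  by rewrite (ReA a Aa) lecR; apply: ge_inf => //; exists a.
have eR : e = (complex.Re e)%:C%C by rewrite RRe_real// gtr0_real.
have Re0 : 0 < complex.Re e by move: e0; rewrite {1}eR (ltcR 0).
have [_ [a Aa <-] ale] := inf_adherent Re0 infB.
by exists a => //; rewrite eR (ReA a Aa) -rmorphD ltcR.
Qed.

(** * Positive definite forms and orthogonal projection *)

Section DotForm.
Context {R : realType} {E : normedModType R[i]}.
Variable f : {dot E for Num.conj}.

Lemma dot_swap u v : f u v = (f v u)^*.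
Proof. by rewrite (hermC f) mul1r. Qed.

Lemma dotZZ a b u v : f (a *: u) (b *: v) = a * b^* * f u v.
Proof. by rewrite linearZl_LR linearZr_LR /= mulrA. Qed.

(** The positivity of the form at <v, v> u - <u, v> v. *)
Lemma cauchy_schwarz u v : `|f u v| ^+ 2 <= f u u * f v v.
Proof.
have [->|v0] := eqVneq v 0.
  by rewrite linear0r normr0 expr0n mulr_ge0 ?dnorm_ge0.
have n0 : 0 < f v v by rewrite dnorm_gt0.
have nr : (f v v)^* = f v v by apply/CrealP/ger0_real/ltW.
have := dnorm_ge0 f (f v v *: u - f u v *: v).
rewrite dnormB !dnormZ dotZZ !rmorphM /= conjCK nr (ger0_norm (ltW n0)) => h.
rewrite -(ler_pM2l n0) -subr_ge0; move: h; rewrite !normCK.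
by congr (is_true (0 <= _)); ring.
Qed.

(** The vector t *: u that comes closest to r has t proportional to <r, u>; for
    t = <r, u> / (1 + <u, u>), which is defined even if u = 0, subtracting it
    from r lowers the squared norm by at least
    |<r, u>|^2 / (1 + <u, u>). *)
Lemma almost_orthogonal r u e :
  (forall t, f r r <= f (r - t *: u) (r - t *: u) + e) ->
  `|f r u| ^+ 2 <= e * (1 + f u u).
Proof.
move=> h; set k := 1 + f u u.
have k0 : 0 < k by rewrite ltr_pwDl// dnorm_ge0.
set a := f r u.
rewrite -ler_pdivrMr//.
have kr : k^* = k by apply/CrealP/ger0_real/ltW.
have := h (a / k).
rewrite dnormB dnormZ !linearZr_LR /= -/a.
have -> : (a / k)^* * a = `|a| ^+ 2 / k.
  by rewrite rmorphM fmorphV /= kr normCK; ring.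
set s := `|a| ^+ 2 / k.
have s0 : 0 <= s by rewrite divr_ge0 ?exprn_ge0// ltW.
have -> : s^* = s by apply/CrealP/ger0_real.
have -> : `|a / k| ^+ 2 * f u u = s * (f u u / k).
  rewrite normrM normfV (gtr0_norm k0) /s; field; exact: lt0r_neq0.
have : s * (f u u / k) <= s.
  by rewrite ler_piMr// ler_pdivrMr// mul1r /k lerDr.
move=> h1 h2.
rewrite -subr_ge0 in h1; rewrite -subr_ge0 in h2; rewrite -subr_ge0.
by move: (addr_ge0 h1 h2); congr (is_true (0 <= _)); ring.
Qed.

(** Parallelogram identity: two almost shortest vectors of a convex set, whose
    midpoint is then no shorter than the infimum d, are close. *)
Lemma near_minimal_close a b d e :
  (4 * d <= f (a + b) (a + b)) -> f a a < d + e -> f b b < d + e ->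
  f (a - b) (a - b) < 4 * e.
Proof.
move=> hd ha hb.
have par : f (a - b) (a - b) = 2 * (f a a + f b b) - f (a + b) (a + b).
  by rewrite dnormB dnormD; ring.
rewrite par ltrBlDr; apply: (@lt_le_trans _ _ (2 * ((d + e) + (d + e)))).
  by rewrite ltr_pM2l// ltrD.
rewrite -subr_ge0; rewrite -subr_ge0 in hd.
by move: hd; congr (is_true (0 <= _)); ring.
Qed.

(** The norm of E and that of the form f need only be equivalent: a product
    carries the maximum norm, which comes from no inner product. *)
Variable c : R[i].
Hypothesis c_ge0 : 0 <= c.
Hypothesis f_bounded : forall x, f x x <= c * `|x| ^+ 2.

Lemma dot_continuous a : continuous (fun x => f x a : R[i]^o).
Proof.
suff : continuous (applyr f a : {linear E -> R[i]^o}) by [].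
apply: bounded_linear_continuous; apply/linear_boundedP.
pose k := sqrtC c * sqrtC (f a a).
near=> r => x /=.
rewrite (@le_trans _ _ (k * `|x|))//; last first.
  rewrite ler_wpM2r//; near: r; apply: nbhs_pinfty_ge.
  by rewrite ger0_real// mulr_ge0 ?sqrtC_ge0 ?dnorm_ge0.
rewrite -(ler_pXn2r (n := 2))// ?nnegrE ?mulr_ge0 ?sqrtC_ge0 ?dnorm_ge0//.
rewrite !exprMn !sqrtCK (le_trans (cauchy_schwarz x a))//.
by rewrite mulrAC ler_wpM2r// dnorm_ge0.
Unshelve. all: by end_near. Qed.

Lemma closed_orthogonal a : closed [set x | f x a = 0].
Proof.
have /continuous_closedP/(_ [set (0 : R[i]^o)]) := @dot_continuous a.
apply; apply: accessible_closed_set1.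
exact/hausdorff_accessible/norm_hausdorff.
Qed.

Lemma orthogonal_closure (A : set E) a :
  (forall x, A x -> f x a = 0) -> forall x, closure A x -> f x a = 0.
Proof.
by move=> h; rewrite closureE; apply: smallest_sub h; exact: closed_orthogonal.
Qed.

Hypothesis f_dominates : forall x, `|x| ^+ 2 <= f x x.
Hypothesis E_complete : forall F : set_system E,
  ProperFilter F -> cauchy F -> exists l : E, F --> l.

(** The points of M that almost minimize the distance to x generate a Cauchy
    filter, by the parallelogram identity. The vectors from its members to x are
    almost orthogonal to M, so the vector from its limit to x is orthogonal. *)
Theorem orthogonal_projection (M : set E) (x : E) :
  linear_manifold M -> closed M ->
  exists2 m, M m & forall u, M u -> f (x - m) u = 0.
Proof.
move=> [/set_mem M0 Mlin] Mclosed.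
have lin a u v : M u -> M v -> M (a *: u + v).
  by move=> /mem_set Mu /mem_set Mv; exact/set_mem/Mlin.
pose A := [set f (x - m) (x - m) | m in M].
have [d d_le d_adh] : exists2 d, (forall a, A a -> d <= a) &
    forall e, 0 < e -> exists2 a, A a & a < d + e.
  apply: nneg_complex_inf; first by exists (f (x - 0) (x - 0)), 0.
  by move=> _ [m _ <-]; exact: dnorm_ge0.
have {}d_le m : M m -> d <= f (x - m) (x - m).
  by move=> Mm; apply: (d_le); exists m.
pose B e := [set m | M m /\ f (x - m) (x - m) < d + e].
pose F := filter_from [set e : R[i] | 0 < e] B.
have FF : ProperFilter F.
  apply: filter_from_proper => [|e /d_adh [_ [m Mm <-] me]]; last by exists m.
  apply: filter_from_filter => [|e1 e2 e10 e20]; first by exists 1 => /=.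
  have le12 : e1 >=< e2 by apply: real_comparable; rewrite gtr0_real.
  have B_mono e e' : e <= e' -> B e `<=` B e'.
    by move=> ee' m [Mm me]; split; rewrite // (lt_le_trans me)// lerD2l.
  by case/orP: le12 => le12; [exists e1|exists e2] => // m Bm; split => //;
    exact: B_mono Bm.
have close e m1 m2 : B e m1 -> B e m2 -> `|m1 - m2| ^+ 2 < 4 * e.
  move=> [Mm1 m1e] [Mm2 m2e]; apply: le_lt_trans (f_dominates _) _.
  have -> : m1 - m2 = (x - m2) - (x - m1) by rewrite opprB [RHS]addrC subrKA.
  apply: near_minimal_close m2e m1e.
  (* the midpoint of m1 and m2 lies in M, hence at distance at least d *)
  have -> : (x - m2) + (x - m1) = 2 *: (x - (2^-1 *: m1 + 2^-1 *: m2)).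
    rewrite scalerBr scalerDr !scalerA divff ?pnatr_eq0// !scale1r.
    by rewrite scaler_nat mulr2n opprD addrACA (addrC (- m2)).
  rewrite dotZZ; have -> : 2 * 2^* = 4 :> R[i].
    by rewrite conjC_nat -natrM.
  rewrite ler_pM2l// d_le//; apply: (lin) => //.
  by rewrite -[X in M X]addr0; apply: (lin).
have [l Fl] : exists l : E, F --> l.
  apply: E_complete; apply: cauchy_exP => e e0.
  have e40 : 0 < e ^+ 2 / 4 by rewrite divr_gt0// exprn_gt0.
  have [_ [m Mm <-] me] := d_adh _ e40.
  exists m; exists (e ^+ 2 / 4) => // y By.
  rewrite -ball_normE /ball_ /= -(ltr_pXn2r (n := 2)) ?nnegrE
    ?normr_ge0 ?(ltW e0)//.
  by rewrite (lt_le_trans (close _ _ _ _ By))// mulrC divfK ?pnatr_eq0.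
have Ml : M l.
  apply: (closed_cvg (FF := FF) (u_ := id)) Fl => //.
  by exists 1 => //= m [].
exists l => // u Mu.
have gl : (fun m => f (x - m) u : R[i]^o) @ F --> (f (x - l) u : R[i]^o).
  have xm : (fun m => x - m) @ F --> x - l.
    by apply: cvgB; [exact: cvg_cst|exact: Fl].
  exact: cvg_comp xm (@dot_continuous u (x - l)).
have g0 : (fun m => f (x - m) u : R[i]^o) @ F --> (0 : R[i]^o).
  apply/cvgr0Pnorm_lt => e e0.
  pose k := 1 + f u u.
  have k0 : 0 < k by rewrite ltr_pwDl// dnorm_ge0.
  exists (e ^+ 2 / k / 2); first by rewrite /= !divr_gt0// exprn_gt0.
  move=> m [Mm me] /=; rewrite -(ltr_pXn2r (n := 2)) ?nnegrE
    ?normr_ge0 ?(ltW e0)//.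
  apply: le_lt_trans (almost_orthogonal (e := e ^+ 2 / k / 2) _) _.
    move=> t; apply: (le_trans (ltW me)); rewrite lerD2r.
    have -> : x - m - t *: u = x - (t *: u + m) by rewrite opprD addrA addrAC.
    by apply: (d_le); apply: (lin).
  rewrite -/k mulrAC divfK ?gt_eqF// gtr_pMr ?exprn_gt0//.
  by rewrite invf_lt1// ltr1n.
exact: (cvg_unique (@norm_hausdorff _ R[i]^o) gl g0).
Qed.
End DotForm.

(** * The Hilbert space H * H *)

Section PairDot.
Context {R : realType} {H : completeNormedModType R[i]}.
Variable dot : {dot H for Num.conj}.

Definition pair_dot (p q : H * H) : R[i] := dot p.1 q.1 + dot p.2 q.2.

Lemma pair_dot_bilinear :
  bilinear_for (@GRing.Scale.Law.clone _ _ ( *%R ) _)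
    (@GRing.Scale.Law.clone _ _ (Num.conj \; *%R ) _) pair_dot.
Proof.
split=> [p|p] a u v; rewrite /pair_dot /=.
- by rewrite !linearPl /= mulrDr addrACA.
- by rewrite !linearPr /= mulrDr addrACA.
Qed.

HB.instance Definition _ := bilinear_isBilinear.Build R[i]
  (H * H)%type (H * H)%type R[i] _ _ pair_dot pair_dot_bilinear.

Lemma pair_dot_hermitian (p q : H * H) :
  pair_dot p q = (-1) ^+ false * (pair_dot q p)^*.
Proof.
by rewrite /pair_dot rmorphD /= mulrDr -!(hermC dot).
Qed.

HB.instance Definition _ := isHermitianSesquilinear.Build R[i] (H * H)%type
  false Num.conj pair_dot pair_dot_hermitian.

Lemma pair_dot_gt0 (p : H * H) : p != 0 -> 0 < pair_dot p p.
Proof.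
case: p => x y; rewrite /pair_dot /= -pair_eqE /= negb_and.
case/orP=> h; [apply: ltr_pwDl|apply: ltr_wpDl]; rewrite ?dnorm_gt0//.
Qed.

HB.instance Definition _ := isDotProduct.Build R[i] (H * H)%type
  pair_dot pair_dot_gt0.

End PairDot.

(** * Adjoints *)

Section Adjoint.
Context {R : realType} {H : completeNormedModType R[i]}.
Variable dot : {dot H for Num.conj}.
Hypothesis hdot : induces_norm dot.
Implicit Types (T : set (H * H)) (D : set H).

Lemma pair_norm_le_dot (p : H * H) : `|p| ^+ 2 <= pair_dot dot p p.
Proof.
rewrite /pair_dot !hdot prod_normE /Num.max.
by case: ifP => _; rewrite ?lerDl ?lerDr exprn_ge0.
Qed.

Lemma pair_dot_le_norm (p : H * H) : pair_dot dot p p <= 2 * `|p| ^+ 2.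
Proof.
have n1 : `|p.1| \is Num.real by rewrite ger0_real.
have n2 : `|p.2| \is Num.real by rewrite ger0_real.
rewrite /pair_dot !hdot mulr2n mulrDl mul1r prod_normE.
by rewrite maxEle; case: (real_leP n1 n2) => h;
  rewrite lerD ?lerXn2r ?nnegrE// ltW.
Qed.

Lemma pair_orthogonal_closure (T : set (H * H)) q :
  (forall p, T p -> pair_dot dot p q = 0) ->
  forall p, closure T p -> pair_dot dot p q = 0.
Proof. exact: (orthogonal_closure (ler0n _ 2) pair_dot_le_norm). Qed.

Lemma dense_orthogonal D a :
  dense D -> (forall x, D x -> dot x a = 0) -> a = 0.
Proof.
move=> Ddense aD; have c1 : forall x, dot x x <= 1 * `|x| ^+ 2.
  by move=> x; rewrite hdot mul1r.
apply/eqP; rewrite -(dnorm_eq0 dot); apply/eqP.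
apply: (orthogonal_closure ler01 c1 aD).
move=> B; rewrite nbhsE => -[U [Uo Ua] UB].
have [y [Uy Dy]] := Ddense U (ex_intro _ a Ua) Uo.
by exists y; split=> //; exact: UB.
Qed.

(** Rotating the graph by (x, y) |-> (y, - x) reduces the properties of adjoints
    to those of orthogonal complements. *)
Lemma adjointP T q :
  adjoint dot T q <-> forall p, T p -> pair_dot dot p (q.2, - q.1) = 0.
Proof.
rewrite /pair_dot /adjoint /=; split => [h [u v] Tuv|h u v Tuv] /=.
  by rewrite linearNr /= (h _ _ Tuv) subrr.
by apply/eqP; rewrite eq_sym -subr_eq0 -linearNr; apply/eqP/(h (u, v)).
Qed.

Lemma adjoint_sub T T' : T `<=` T' -> adjoint dot T' `<=` adjoint dot T.
Proof. by move=> TT' q h u v /TT'; exact: h. Qed.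

Lemma adjoint_closure T : adjoint dot (closure T) = adjoint dot T.
Proof.
apply/seteqP; split; first exact/adjoint_sub/subset_closure.
by move=> q /adjointP h; apply/adjointP; exact: pair_orthogonal_closure.
Qed.

Lemma adjoint_closed T : closure (adjoint dot T) `<=` adjoint dot T.
Proof.
move=> q hq u v Tuv.
have e p : pair_dot dot p (v, - u) = (dot v p.1 - dot u p.2)^*.
  by rewrite /pair_dot /= linearNr rmorphB /= -!dot_swap.
have : pair_dot dot q (v, - u) = 0.
  apply: pair_orthogonal_closure hq => p hp.
  by rewrite e (hp _ _ Tuv) subrr rmorph0.
by rewrite e => /eqP; rewrite conjC_eq0 subr_eq0 => /eqP.
Qed.

Lemma adjoint_linear T : linear_manifold (adjoint dot T).
Proof.
apply/linear_manifoldP; split => [u v _|a [x y] [x' y'] h h' u v Tuv].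
  by rewrite !linear0r.
rewrite /= !linearDr !linearZr_LR /=.
by rewrite (h _ _ Tuv) (h' _ _ Tuv).
Qed.

Lemma adjoint_functional T x y z : dense (op_dom T) ->
  adjoint dot T (x, y) -> adjoint dot T (x, z) -> y = z.
Proof.
move=> Tdense xy xz; apply/eqP; rewrite -subr_eq0; apply/eqP.
apply: dense_orthogonal Tdense _ => u [v Tuv].
have /= exy := xy _ _ Tuv; have /= exz := xz _ _ Tuv.
by rewrite linearBr /= -exy -exz subrr.
Qed.

Lemma closure_projection T (p : H * H) : linear_manifold T ->
  exists2 m, closure T m & forall q, T q -> pair_dot dot (p - m) q = 0.
Proof.
move=> /linear_closure Tlin.
have [m Tm h] := orthogonal_projection (ler0n _ 2) pair_dot_le_norm
  pair_norm_le_dot (@prod_complete _ H H) p Tlin (@closed_closure _ _).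
by exists m => // q /subset_closure; exact: h.
Qed.

(** If (y, w) is the projection of (h, 0) onto the closure of T, orthogonality
    of (h - y, - w) to the graph of T says that w is in the domain of T*, with
    T* w = h - y. *)
Lemma range_one_plus_adjoint_mul T h : linear_manifold T ->
  exists y, op_mul (adjoint dot T) (op_closure T) (y, h - y).
Proof.
move=> /(closure_projection (h, 0)) [[y w] Tyw orth].
exists y; exists w => //= u v Tuv.
have /= := orth _ Tuv; rewrite /pair_dot /= sub0r linearNl.
move=> /eqP; rewrite subr_eq0 => /eqP e.
by rewrite (dot_swap dot v) (dot_swap dot u) e.
Qed.

(** Let T' be the closure of T. The graph of T* T' contains some (y, a - y), and
    this pair is approximated by pairs (u, T* T' u) with u in D; so
    <a, a> = 0. *)
Lemma core_range_dense T D a : linear_manifold T ->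
  is_core D (op_mul (adjoint dot T) (op_closure T)) ->
  (forall u v, D u -> op_mul (adjoint dot T) (op_closure T) (u, v) ->
     dot (u + v) a = 0) ->
  a = 0.
Proof.
move=> Tlin [_ _ coreE] orth.
have /= [y] := range_one_plus_adjoint_mul a Tlin.
rewrite -coreE => ya.
have : pair_dot dot (y, a - y) (a, a) = 0.
  apply: pair_orthogonal_closure ya => -[u v] [uv Du].
  by rewrite /pair_dot /= -linearDl; exact: orth.
rewrite /pair_dot /= -linearDl /= subrKC => /eqP.
by rewrite dnorm_eq0 => /eqP.
Qed.

Lemma restrict_linear T D : linear_manifold T -> linear_manifold D ->
  linear_manifold (op_restrict T D).
Proof.
move=> /linear_manifoldP[T0 Tlin] /linear_manifoldP[D0 Dlin].
apply/linear_manifoldP; split=> // a u v [Tu Du] [Tv Dv].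
by split; [exact: Tlin|exact: Dlin].
Qed.

Lemma symmetric_sub_adjoint T : symmetric_op dot T -> T `<=` adjoint dot T.
Proof. by move=> [_ _ Tsym] [x y] Txy u v Tuv; exact: Tsym Tuv Txy. Qed.

(** * Essential self-adjointness *)

(** The closure C of the restriction satisfies C <= T' <= T* <= C, where T' is
    the closure of T; the last inclusion is the one that uses the core. *)
Theorem essentially_self_adjoint_of_core T D :
  symmetric_op dot T -> linear_manifold D -> dense D ->
  D `<=` op_dom (op_mul T T) ->
  is_core D (op_mul (adjoint dot T) (op_closure T)) ->
  essentially_self_adjoint_on dot T D.
Proof.
move=> Tsym Dlin Ddense DT2 Dcore.
have [[Tlin _] Tdense _] := Tsym.
have DT : D `<=` op_dom T by move=> u /DT2 [v [w Tuw _]]; exists w.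
have T_adj := symmetric_sub_adjoint Tsym.
set C := op_closure (op_restrict T D).
have CT : C `<=` closure T by apply: closureS => p [].
have cl_adj : closure T `<=` adjoint dot T.
  by apply: subset_trans (@adjoint_closed T); exact: closureS.
have adj_C : adjoint dot T `<=` C.
  move=> p adj_p.
  have [m Cm orth] := closure_projection p (restrict_linear Tlin Dlin).
  have adj_m : adjoint dot T m by exact/cl_adj/CT.
  have : adjoint dot T (p - m).
    have /linear_manifoldP[_ lin] := adjoint_linear T.
    by rewrite addrC -scaleN1r; exact: lin.
  move E : (p - m) orth => [a b] orth adj_ab.
  (* on D, T* T' is T T, since T* is single-valued and extends T and T' *)
  have a0 : a = 0.
    apply: (core_range_dense Tlin Dcore) => u v Du [w /= Tuw adj_wv].
    have [v' [w' /= Tuw' Tw'v']] := DT2 _ Du.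
    have ww' : w = w'.
      by apply: adjoint_functional Tdense _ _; [exact: cl_adj Tuw|exact: T_adj].
    rewrite ww' in adj_wv.
    have vv' : v = v'.
      by apply: adjoint_functional Tdense adj_wv _; exact: T_adj.
    have /= := orth (u, w') (conj Tuw' Du).
    rewrite /pair_dot /= (dot_swap dot b) -(adj_ab _ _ Tw'v') -dot_swap => e.
    by rewrite (dot_swap dot) linearDr /= vv' e rmorph0.
  have b0 : b = 0.
    apply: (adjoint_functional Tdense (x := 0)); first by rewrite -{1}a0.
    by have /linear_manifoldP[] := adjoint_linear T.
  have : p - m = 0 by rewrite E a0 b0.
  by move=> /eqP; rewrite subr_eq0 => /eqP ->.
have CE : C = adjoint dot T.
  by apply/seteqP; split=> //; exact: subset_trans CT cl_adj.
have clE : closure T = C.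
  by apply/seteqP; split=> //; rewrite CE.
split => //; split.
- split; first exact/linear_closure/restrict_linear.
  by rewrite -/C CE => x y z; exact: adjoint_functional.
- move=> U U0 Uo; have [x [Ux Dx]] := Ddense U U0 Uo.
  have [y Txy] := DT _ Dx.
  by exists x; split => //; exists y; exact: subset_closure.
- by rewrite -/C -[in LHS]clE adjoint_closure CE.
Qed.

Lemma op_add_symmetric A B : symmetric_op dot A -> symmetric_op dot B ->
  dense (op_dom (op_add A B)) -> symmetric_op dot (op_add A B).
Proof.
move=> [[/linear_manifoldP[A0 Alin] Afun] _ Asym].
move=> [[/linear_manifoldP[B0 Blin] Bfun] _ Bsym] Tdense.
split=> //; first split.
- apply/linear_manifoldP; split; first by exists 0, 0; rewrite addr0.
  move=> a [x _] [x' _] /= [y [z /= [Ay Bz ->]]] [y' [z' /= [Ay' Bz' ->]]].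
  exists (a *: y + y'), (a *: z + z'); split.
  + exact: (Alin a (x, y) (x', y')).
  + exact: (Blin a (x, z) (x', z')).
  + by rewrite /= scalerDr addrACA.
- move=> x _ _ [y [z /= [Ay Bz ->]]] [y' [z' /= [Ay' Bz' ->]]].
  by rewrite (Afun _ _ _ Ay Ay') (Bfun _ _ _ Bz Bz').
- move=> x _ u _ [y [z /= [Ay Bz ->]]] [y' [z' /= [Ay' Bz' ->]]].
  by rewrite linearDl linearDr /= (Asym _ _ _ _ Ay Ay') (Bsym _ _ _ _ Bz Bz').
Qed.
End Adjoint.

Theorem theorem4 (R : realType) (H : completeNormedModType R[i])
  (dot : {dot H for Num.conj}) (hdot : induces_norm dot)
  (A B : set (H * H))
  (hA : symmetric_op dot A) (hB : symmetric_op dot B)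
  (D : set H) (hDlin : linear_manifold D) (hDdense : dense D)
  (hD : D `<=` op_dom (op_mul (op_add A B) (op_add A B)))
  (hcore : is_core D
    (op_mul (adjoint dot (op_add A B)) (op_closure (op_add A B)))) :
  essentially_self_adjoint_on dot (op_add A B) D.
Proof.
apply: essentially_self_adjoint_of_core => //.
apply: op_add_symmetric => // U U0 Uo.
have [x [Ux Dx]] := hDdense U U0 Uo.
by exists x; split=> //; have [z [y Txy _]] := hD _ Dx; exists y.
Qed.
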